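(* Let $k$ be an algebraically closed field, let $A$ be a residually finite dimensional algebra over $k$ (not necessarily associative), and let $Q$ be a homogeneous polynomial in $n$ variables (an element of the free algebra on $x_1,\dots,x_n$ over $k$ in the category of algebras to which $A$ belongs). Then the following are equivalent: (1) The polynomial $Q$ is an almost identity for $A$. (2) The polynomial $Q$ is an identity for some ideal $I$ of $A$ of finite codimension.
   Context: An algebra over $k$ is a $k$-vector space $A$, possibly of infinite dimension, with a $k$-bilinear multiplication $A\times A\to A$; no associativity, commutativity or unit is assumed. One may work in the category of all algebras, or of associative (possibly non-unital), Lie, or Jordan algebras; a polynomial $Q$ in $n$ variables is an element of the free (non-unital) algebra on $x_1,\dots,x_n$ over $k$ in the respective category, and homogeneous refers to total degree. An ideal always means a two-sided ideal. $A$ is residually finite dimensional if the intersection of all ideals of $A$ of finite codimension (as $k$-subspaces) is zero. The polynomial $Q$ defines an evaluation map $e_Q\colon A^n\to A$, $(a_1,\dots,a_n)\mapsto Q(a_1,\dots,a_n)$. For a $k$-vector space $V$ and a positive integer $n$, the codimension of a subset $X\subset V^n$ is the smallest integer $c$ for which there exist a direct sum decomposition of $k$-vector spaces $V^n=V_1\oplus V_2$ with $V_2$ finite dimensional and an algebraic (Zariski closed) set $X_2\subset V_2$ of codimension $c$ in $V_2$ such that $X\supset V_1\times X_2$ (identified with $\{v_1+v_2: v_1\in V_1, v_2\in X_2\}$). If no such decomposition exists, $X$ has infinite codimension. $\mathrm{cd}_Q A$ denotes the codimension of $e_Q^{-1}(0)$ in $A^n$. $Q$ is an almost identity for $A$ if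 $\mathrm{cd}_Q A<\infty$, and $Q$ is an identity for $A$ if $e_Q(A^n)=0$ (equivalently $\mathrm{cd}_Q A=0$). An ideal $I$ is regarded as an algebra in its own right, so $Q$ is an identity for $I$ if $Q(y_1,\dots,y_n)=0$ for all $y_1,\dots,y_n\in I$. *)

(* Defs.v *)
From HB Require Import structures.
From mathcomp Require Import all_boot all_order all_algebra sesquilinear.
From mathcomp Require Import mathcomp_extra boolp classical_sets.
From mathcomp Require mpoly.

Set Implicit Arguments.
Unset Strict Implicit.
Unset Printing Implicit Defensive.

Import GRing.Theory.
Local Open Scope classical_set_scope.
Local Open Scope ring_scope.

(* An algebra over k is an lmodType A with a multiplication                   *)
(* mul : {bilinear A -> A -> A}; the dimension is arbitrary.                  *)

Variant alg_category := AllAlg | AssocAlg | LieAlg | JordanAlg.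

Definition in_category (C : alg_category) (k : fieldType) (A : lmodType k)
    (mul : A -> A -> A) : Prop :=
  match C with
  | AllAlg => True
  | AssocAlg => associative mul
  | LieAlg => (forall x, mul x x = 0) /\
      (forall x y z,
         mul x (mul y z) + mul y (mul z x) + mul z (mul x y) = 0)
  | JordanAlg => commutative mul /\
      (forall x y, mul (mul x y) (mul x x) = mul x (mul y (mul x x)))
  end.

(* The free non-unital algebra of a category: formal expressions in the       *)
(* variables, modulo the congruence generated by the algebra axioms and the   *)
(* identities of the category.                                                *)

Inductive alg_term (k : fieldType) (n : nat) : Type :=
  | TVar of 'I_n
  | TZero
  | TAdd of alg_term k n & alg_term k n
  | TScale of k & alg_term k n
  | TMul of alg_term k n & alg_term k n.
Arguments TVar {k n}.
Arguments TZero {k n}.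

HB.instance Definition _ k n := gen_eqMixin (alg_term k n).
HB.instance Definition _ k n := gen_choiceMixin (alg_term k n).

Inductive alg_cong (C : alg_category) (k : fieldType) (n : nat) :
    alg_term k n -> alg_term k n -> Prop :=
  | cong_refl s : alg_cong C s s
  | cong_sym s t : alg_cong C s t -> alg_cong C t s
  | cong_trans s t u : alg_cong C s t -> alg_cong C t u -> alg_cong C s u
  | cong_add s s' t t' : alg_cong C s s' -> alg_cong C t t' ->
      alg_cong C (TAdd s t) (TAdd s' t')
  | cong_scale a s s' : alg_cong C s s' ->
      alg_cong C (TScale a s) (TScale a s')
  | cong_mul s s' t t' : alg_cong C s s' -> alg_cong C t t' ->
      alg_cong C (TMul s t) (TMul s' t')
  | cong_addA s t u : alg_cong C (TAdd s (TAdd t u)) (TAdd (TAdd s t) u)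
  | cong_addC s t : alg_cong C (TAdd s t) (TAdd t s)
  | cong_add0 s : alg_cong C (TAdd TZero s) s
  | cong_addN s : alg_cong C (TAdd (TScale (-1) s) s) TZero
  | cong_scaleA a b s : alg_cong C (TScale a (TScale b s)) (TScale (a * b) s)
  | cong_scale1 s : alg_cong C (TScale 1 s) s
  | cong_scaleDr a s t :
      alg_cong C (TScale a (TAdd s t)) (TAdd (TScale a s) (TScale a t))
  | cong_scaleDl a b s :
      alg_cong C (TScale (a + b) s) (TAdd (TScale a s) (TScale b s))
  | cong_mulDl s t u :
      alg_cong C (TMul (TAdd s t) u) (TAdd (TMul s u) (TMul t u))
  | cong_mulDr s t u :
      alg_cong C (TMul s (TAdd t u)) (TAdd (TMul s t) (TMul s u))
  | cong_mulZl a s t : alg_cong C (TMul (TScale a s) t) (TScale a (TMul s t))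
  | cong_mulZr a s t : alg_cong C (TMul s (TScale a t)) (TScale a (TMul s t))
  | cong_assoc s t u : C = AssocAlg ->
      alg_cong C (TMul s (TMul t u)) (TMul (TMul s t) u)
  | cong_lie_alt s : C = LieAlg -> alg_cong C (TMul s s) TZero
  | cong_lie_jacobi s t u : C = LieAlg ->
      alg_cong C (TAdd (TAdd (TMul s (TMul t u)) (TMul t (TMul u s)))
                       (TMul u (TMul s t))) TZero
  | cong_jordan_comm s t : C = JordanAlg -> alg_cong C (TMul s t) (TMul t s)
  | cong_jordan s t : C = JordanAlg ->
      alg_cong C (TMul (TMul s t) (TMul s s)) (TMul s (TMul t (TMul s s))).

Section FreeAlgebra.
Variables (C : alg_category) (k : fieldType) (n : nat).
Local Notation term := (alg_term k n).
Implicit Types s t u : term.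

Definition alg_congb : rel term := fun s t => `[< alg_cong C s t >].

Fact alg_congb_equiv : equiv_class_of alg_congb.
Proof.
split=> [s|s t|t s u].
- by apply/asboolP; exact: cong_refl.
- by apply/asboolP/asboolP => ?; exact: cong_sym.
- by move=> /asboolP st /asboolP tu; apply/asboolP; exact: cong_trans st tu.
Qed.
Canonical alg_cong_equiv := EquivRelPack alg_congb_equiv.

Definition free_alg : Type := {eq_quot alg_cong_equiv}%qT.
HB.instance Definition _ := Choice.on free_alg.
HB.instance Definition _ : EqQuotient term alg_congb free_alg :=
  EqQuotient.on free_alg.


Definition fa_class s : free_alg := (\pi_free_alg s)%qT.

Fact fa_class_repr (x : free_alg) : fa_class (repr x) = x.
Proof. exact: reprK. Qed.

Fact fa_classP s t : fa_class s = fa_class t <-> alg_cong C s t.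
Proof.
split=> [/eqP|st]; first by rewrite piE => /asboolP.
by apply/eqP; rewrite piE; apply/asboolP.
Qed.

Fact repr_fa_class s : alg_cong C (repr (fa_class s)) s.
Proof. by apply/fa_classP; rewrite fa_class_repr. Qed.

Definition fa_add (x y : free_alg) := fa_class (TAdd (repr x) (repr y)).
Definition fa_opp (x : free_alg) := fa_class (TScale (-1) (repr x)).
Definition fa_scale (a : k) (x : free_alg) := fa_class (TScale a (repr x)).
Definition fa_mul (x y : free_alg) := fa_class (TMul (repr x) (repr y)).
Definition fa_var (i : 'I_n) : free_alg := fa_class (TVar i).

Fact fa_addE s t : fa_add (fa_class s) (fa_class t) = fa_class (TAdd s t).
Proof. by apply/fa_classP; apply: cong_add; apply: repr_fa_class. Qed.
Fact fa_oppE s : fa_opp (fa_class s) = fa_class (TScale (-1) s).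
Proof. by apply/fa_classP; apply: cong_scale; apply: repr_fa_class. Qed.
Fact fa_scaleE a s : fa_scale a (fa_class s) = fa_class (TScale a s).
Proof. by apply/fa_classP; apply: cong_scale; apply: repr_fa_class. Qed.
Fact fa_mulE s t : fa_mul (fa_class s) (fa_class t) = fa_class (TMul s t).
Proof. by apply/fa_classP; apply: cong_mul; apply: repr_fa_class. Qed.

Fact fa_ind (P : free_alg -> Prop) :
  (forall s, P (fa_class s)) -> forall x, P x.
Proof. by move=> Ps x; rewrite -(fa_class_repr x). Qed.

Fact fa_addA : associative fa_add.
Proof.
elim/fa_ind=> s; elim/fa_ind=> t; elim/fa_ind=> u.
by rewrite !fa_addE; apply/fa_classP/cong_addA.
Qed.
Fact fa_addC : commutative fa_add.
Proof.
elim/fa_ind=> s; elim/fa_ind=> t.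
by rewrite !fa_addE; apply/fa_classP/cong_addC.
Qed.
Fact fa_add0 : left_id (fa_class TZero) fa_add.
Proof. by elim/fa_ind=> s; rewrite fa_addE; apply/fa_classP/cong_add0. Qed.
Fact fa_addN : left_inverse (fa_class TZero) fa_opp fa_add.
Proof.
by elim/fa_ind=> s; rewrite fa_oppE fa_addE; apply/fa_classP/cong_addN.
Qed.
HB.instance Definition _ :=
  GRing.isZmodule.Build free_alg fa_addA fa_addC fa_add0 fa_addN.

Fact fa_scaleA a b x : fa_scale a (fa_scale b x) = fa_scale (a * b) x.
Proof.
by elim/fa_ind: x => s; rewrite !fa_scaleE; apply/fa_classP/cong_scaleA.
Qed.
Fact fa_scale1 : left_id 1 fa_scale.
Proof. by elim/fa_ind=> s; rewrite fa_scaleE; apply/fa_classP/cong_scale1. Qed.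
Fact fa_scaleDr : right_distributive fa_scale +%R.
Proof.
move=> a; elim/fa_ind=> s; elim/fa_ind=> t.
rewrite -[fa_class s + _]/(fa_add _ _) -[RHS]/(fa_add _ _).
rewrite fa_addE !fa_scaleE fa_addE.
exact/fa_classP/cong_scaleDr.
Qed.
Fact fa_scaleDl x : {morph fa_scale^~ x : a b / a + b}.
Proof.
elim/fa_ind: x => s a b; rewrite -[RHS]/(fa_add _ _) !fa_scaleE fa_addE.
exact/fa_classP/cong_scaleDl.
Qed.
HB.instance Definition _ := GRing.Zmodule_isLmodule.Build k free_alg
  fa_scaleA fa_scale1 fa_scaleDr fa_scaleDl.

Fact fa_class_add s t : fa_class s + fa_class t = fa_class (TAdd s t).
Proof. exact: fa_addE. Qed.
Fact fa_class_scale a s : a *: fa_class s = fa_class (TScale a s).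
Proof. exact: fa_scaleE. Qed.

Fact fa_mul_bilinear : bilinear_for *:%R *:%R fa_mul.
Proof.
split=> x a; elim/fa_ind: x => s; elim/fa_ind=> t; elim/fa_ind=> u /=;
  rewrite (fa_class_scale a t) (fa_class_add (TScale a t) u) !fa_mulE;
  rewrite fa_class_scale fa_class_add; apply/fa_classP.
- apply: cong_trans (cong_mulDl _ _ _ _) _.
  by apply: cong_add; [apply: cong_mulZl | apply: cong_refl].
- apply: cong_trans (cong_mulDr _ _ _ _) _.
  by apply: cong_add; [apply: cong_mulZr | apply: cong_refl].
Qed.
HB.instance Definition _ := bilinear_isBilinear.Build k free_alg free_alg
  free_alg *:%R *:%R fa_mul fa_mul_bilinear.



Fact free_alg_in_category : in_category C fa_mul.
Proof.
suff in_cat D : C = D -> in_category D fa_mul by exact: in_cat.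
case: D => // eC /=.
- elim/fa_ind=> s; elim/fa_ind=> t; elim/fa_ind=> u.
  by rewrite !fa_mulE; apply/fa_classP/cong_assoc.
- split; first by elim/fa_ind=> s; rewrite fa_mulE; apply/fa_classP/cong_lie_alt.
  elim/fa_ind=> s; elim/fa_ind=> t; elim/fa_ind=> u.
  rewrite !fa_mulE (fa_class_add (TMul s _)) (fa_class_add _ (TMul u _)).
  exact/fa_classP/cong_lie_jacobi.
- split; elim/fa_ind=> s; elim/fa_ind=> t; rewrite !fa_mulE; apply/fa_classP.
    exact: cong_jordan_comm.
  exact: cong_jordan.
Qed.

End FreeAlgebra.

Arguments fa_var {C k n}.

Inductive monomial (n : nat) : Type :=
  | MVar of 'I_n
  | MMul of monomial n & monomial n.

Fixpoint mon_degree n (u : monomial n) : nat :=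
  match u with
  | MVar _ => 1%N
  | MMul v w => (mon_degree v + mon_degree w)%N
  end.

Fixpoint fa_mon C (k : fieldType) n (u : monomial n) : free_alg C k n :=
  match u with
  | MVar i => fa_var i
  | MMul v w => fa_mul (fa_mon C k v) (fa_mon C k w)
  end.

Definition homogeneous C (k : fieldType) n (Q : free_alg C k n) : Prop :=
  exists (d m : nat) (c : 'I_m -> k) (u : 'I_m -> monomial n),
    (forall i, mon_degree (u i) = d) /\ Q = \sum_i c i *: fa_mon C k (u i).

Section Evaluation.
Variables (C : alg_category) (k : fieldType) (n : nat).
Variables (A : lmodType k) (mul : {bilinear A -> A -> A}).
Implicit Types (Q : free_alg C k n) (a : {ffun 'I_n -> A}).

Fixpoint term_eval (a : {ffun 'I_n -> A}) (s : alg_term k n) : A :=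
  match s with
  | TVar i => a i
  | TZero => 0
  | TAdd t u => term_eval a t + term_eval a u
  | TScale b t => b *: term_eval a t
  | TMul t u => mul (term_eval a t) (term_eval a u)
  end.

(* Meaningful when mul is in the category C: the value then does not depend   *)
(* on the representative of Q, and fa_eval^~ a is the unique algebra morphism *)
(* mapping each variable i to a i.                                            *)
Definition fa_eval Q a : A := term_eval a (repr Q).

Fact term_eval_cong a s t : in_category C mul ->
  alg_cong C s t -> term_eval a s = term_eval a t.
Proof.
move=> mulC; elim=> //=; try by [move=> *; congruence].
- by move=> *; rewrite addrA.
- by move=> *; rewrite addrC.
- by move=> *; rewrite add0r.
- by move=> *; rewrite scaleN1r addNr.
- by move=> *; rewrite scalerA.
- by move=> *; rewrite scale1r.
- by move=> *; rewrite scalerDr.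
- by move=> *; rewrite scalerDl.
- by move=> *; rewrite linearDl.
- by move=> *; rewrite linearDr.
- by move=> *; rewrite linearZl_LR.
- by move=> *; rewrite linearZr.
- by move=> r t' u eC; move: mulC; rewrite eC => /(_ _ _ _).
- by move=> r eC; move: mulC; rewrite eC => -[+ _] => /(_ _).
- by move=> r t' u eC; move: mulC; rewrite eC => -[_ +] => /(_ _ _ _).
- by move=> r t' eC; move: mulC; rewrite eC => -[+ _] => /(_ _ _).
- by move=> r t' eC; move: mulC; rewrite eC => -[_ +] => /(_ _ _).
Qed.

Fact fa_eval_class a s : in_category C mul ->
  fa_eval (fa_class C s) a = term_eval a s.
Proof. by move=> mulC; apply/term_eval_cong/repr_fa_class. Qed.

Fact fa_eval_morphism a : in_category C mul ->
  [/\ forall i, fa_eval (fa_var i) a = a i,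
      forall b Q R, fa_eval (b *: Q + R) a = b *: fa_eval Q a + fa_eval R a
    & forall Q R, fa_eval (fa_mul Q R) a = mul (fa_eval Q a) (fa_eval R a)].
Proof.
move=> mulC; split=> [i|b|].
- exact: fa_eval_class.
- elim/fa_ind=> s; elim/fa_ind=> t.
  by rewrite fa_class_scale fa_class_add !fa_eval_class.
- by elim/fa_ind=> s; elim/fa_ind=> t; rewrite fa_mulE !fa_eval_class.
Qed.

Fact fa_eval_unique a (f : {linear free_alg C k n -> A}) :
    in_category C mul -> (forall i, f (fa_var i) = a i) ->
    (forall Q R, f (fa_mul Q R) = mul (f Q) (f R)) ->
  forall Q, f Q = fa_eval Q a.
Proof.
move=> mulC fX fM; elim/fa_ind=> s; rewrite fa_eval_class //.
elim: s => [i||s IHs t IHt|b s IHs|s IHs t IHt] /=.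
- exact: fX.
- exact: (linear0 f).
- by rewrite -fa_class_add linearD IHs IHt.
- by rewrite -fa_class_scale linearZ IHs.
- by rewrite -fa_mulE fM IHs IHt.
Qed.

Definition zero_locus Q : set {ffun 'I_n -> A} := [set a | fa_eval Q a = 0].

Definition identity_on Q (I : set A) : Prop :=
  forall a, (forall i, I (a i)) -> fa_eval Q a = 0.

Definition is_ideal (I : set A) : Prop :=
  submod_closed [in I] /\
  (forall x y, I y -> I (mul x y) /\ I (mul y x)).

(* The quotient A / U is spanned by the classes of finitely many vectors.     *)
Definition finite_codim (U : set A) : Prop :=
  exists (m : nat) (e : 'I_m -> A),
    forall x, exists c : 'I_m -> k, U (x - \sum_i c i *: e i).

Definition residually_finite_dim : Prop :=
  \bigcap_(I in [set I | is_ideal I /\ finite_codim I]) I = [set 0].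

End Evaluation.

Section ZariskiTopology.
Variables (k : fieldType) (m : nat).
Local Notation affine := ('I_m -> k).
Implicit Types Y Z : set affine.

Definition zariski_closed Y : Prop :=
  exists S : set (mpoly.mpoly m k),
    Y = [set x | forall p, S p -> mpoly.meval x p = 0].

Definition irreducible_closed Z : Prop :=
  [/\ zariski_closed Z, Z !=set0
    & forall Z1 Z2, zariski_closed Z1 -> zariski_closed Z2 ->
        Z `<=` Z1 `|` Z2 -> Z `<=` Z1 \/ Z `<=` Z2].

Definition irreducible_chain Y (d : nat) : Prop :=
  exists Z : nat -> set affine,
    (forall i, (i <= d)%N -> irreducible_closed (Z i) /\ Z i `<=` Y) /\
    (forall i, (i < d)%N -> Z i `<` Z i.+1).

(* The empty set has no dimension in this sense, hence infinite codimension.  *)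
Definition has_dim Y (d : nat) : Prop :=
  irreducible_chain Y d /\ ~ irreducible_chain Y d.+1.

End ZariskiTopology.

Section Codimension.
Variables (k : fieldType) (W : lmodType k).
Implicit Types (V : set W) (X : set W).

Definition is_basis V m (e : 'I_m -> W) : Prop :=
  V = [set \sum_i c i *: e i | c in [set: 'I_m -> k]] /\
  (forall c : 'I_m -> k, \sum_i c i *: e i = 0 -> forall i, c i = 0).

Definition direct_sum_decomposition (V1 V2 : set W) : Prop :=
  [/\ submod_closed [in V1], submod_closed [in V2], V1 `&` V2 = [set 0]
    & forall w, exists v1 v2, [/\ V1 v1, V2 v2 & w = v1 + v2]].

(* The Zariski topology of V2 is that of k^m through a basis of V2; it does   *)
(* not depend on the basis. The codimension of X2 in V2 is dim V2 - dim X2.   *)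
Definition algebraic_of_codim (V2 X2 : set W) (c : nat) : Prop :=
  exists (m : nat) (e : 'I_m -> W) (Y : set ('I_m -> k)) (d : nat),
    [/\ is_basis V2 e, zariski_closed Y,
        X2 = [set \sum_i x i *: e i | x in Y], has_dim Y d & (c + d = m)%N].

Definition contains_algebraic X (c : nat) : Prop :=
  exists V1 V2 X2 : set W,
    [/\ direct_sum_decomposition V1 V2, algebraic_of_codim V2 X2 c
      & forall v1 v2, V1 v1 -> X2 v2 -> X (v1 + v2)].

Fact contains_algebraicP X :
  (exists c, contains_algebraic X c) -> exists c, `[< contains_algebraic X c >].
Proof. by case=> c Xc; exists c; apply/asboolP. Qed.

(* None stands for infinite codimension. *)
Definition codim X : option nat :=
  match pselect (exists c, contains_algebraic X c) with
  | left Xfin => Some (ex_minn (contains_algebraicP Xfin))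
  | right _ => None
  end.

End Codimension.

Definition cd C (k : fieldType) n (A : lmodType k)
    (mul : {bilinear A -> A -> A}) (Q : free_alg C k n) : option nat :=
  codim (zero_locus mul Q).

Definition almost_identity C (k : fieldType) n (A : lmodType k)
    (mul : {bilinear A -> A -> A}) (Q : free_alg C k n) : Prop :=
  cd mul Q <> None.

(* Main.v *)
Require Import Defs.
From HB Require Import structures.
From mathcomp Require Import all_boot all_order all_algebra sesquilinear.
From mathcomp Require Import mathcomp_extra boolp classical_sets.
From mathcomp Require mpoly.

Set Implicit Arguments.
Unset Strict Implicit.
Unset Printing Implicit Defensive.

Import GRing.Theory.
Local Open Scope classical_set_scope.
Local Open Scope ring_scope.

(** A set of finite codimension contains a whole coset [b + U] of a subspace
    [U] of finite codimension in [A ^ n] ([contains_algebraic_coset]), and this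
    is all that is used of an almost identity. If [Q] is homogeneous of degree
    [d] and vanishes on [b + U], then for [w] in [U] and [t] nonzero
    [Q (w + t b) = t ^ d Q (b + t^-1 w) = 0]. The left-hand side is polynomial
    in [t] and the field is infinite, so the equality persists at [t = 0]:
    [Q] vanishes on [U] itself ([homogeneous_zero_coset]).

    The subspace [U] need not contain a power of an ideal of finite
    codimension. It does however become dense in such a power for the topology
    defined by the ideals of finite codimension: if [J] is an ideal of finite
    codimension for which the image of [J ^ n] in the finite-dimensional
    quotient of [A ^ n] by [U] has the least possible dimension, then replacing
    [J] by a smaller ideal [J'] of finite codimension leaves this image
    unchanged, so that every point of [J ^ n] is congruent to a point of [U]
    modulo [J'] ([ideal_power_dense]). Evaluation respects congruences modulo
    ideals. Hence the values of [Q] on [J ^ n] lie in every ideal of finite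
    codimension, and they vanish since [A] is residually finite dimensional
    ([identity_on_dense_ideal]).

    Conversely, if [Q] is an identity for an ideal [I] of finite codimension,
    its zero locus contains [I ^ n], which is a subspace of finite codimension
    ([finite_codim_power]); the origin of a complement serves as the closed set
    ([contains_algebraic_subspace]).

    Subspaces of finite codimension are handled as kernels of linear maps to
    finite-dimensional spaces, a description that is visibly stable under
    intersections and finite powers. *)

(** * Subspaces of finite codimension *)

Section FiniteCodimension.
Variable k : fieldType.
Implicit Types W : lmodType k.

Lemma submod_closed_setE W (U : set W) :
  submod_closed [in U] <->
  U 0 /\ forall a x y, U x -> U y -> U (a *: x + y).
Proof.
split=> -[U0 UD]; split=> [|a x y]; move: U0; rewrite ?in_setE // => _.
  by have := UD a x y; rewrite !in_setE.
exact: UD.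
Qed.

Lemma submod_closedB_set W (U : set W) x y :
  submod_closed [in U] -> U x -> U y -> U (x - y).
Proof.
by move=> /submod_closed_setE[U0 UD] Ux Uy; rewrite addrC -scaleN1r; apply: UD.
Qed.

Lemma submod_closedD_set W (U : set W) x y :
  submod_closed [in U] -> U x -> U y -> U (x + y).
Proof.
by move=> /submod_closed_setE[U0 UD] Ux Uy; rewrite -[x]scale1r; apply: UD.
Qed.

Lemma submod_closed_image W (V : lmodType k) (f : {linear W -> V}) (S : set W) :
  submod_closed [in S] -> submod_closed [in f @` S].
Proof.
move=> /submod_closed_setE[S0 SD]; apply/submod_closed_setE; split.
  by exists 0; rewrite ?linear0.
move=> a _ _ [x Sx <-] [y Sy <-]; exists (a *: x + y); last exact: linearP.
exact: SD.
Qed.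

Lemma submod_closed_power W n (I : set W) :
  submod_closed [in I] ->
  submod_closed [in [set a : {ffun 'I_n -> W} | forall i, I (a i)]].
Proof.
move=> /submod_closed_setE[I0 ID]; apply/submod_closed_setE; split=> [i|].
  by rewrite ffunE.
by move=> a x y Ix Iy i; rewrite !ffunE; apply: ID.
Qed.

(** A vector space contained in the given set and of maximal dimension among
    such spaces must be the whole set. *)
Lemma submod_closed_vspace (V : vectType k) (S : set V) :
  submod_closed [in S] -> exists U : {vspace V}, forall v, S v <-> v \in U.
Proof.
move=> Ssub; have /submod_closed_setE[S0 SD] := Ssub.
pose P r := `[< exists U : {vspace V},
  \dim U = r /\ forall v, v \in U -> S v >].
have exP : exists r, P r.
  exists 0%N; apply/asboolP; exists 0%VS; split; first exact: dimv0.
  by move=> v; rewrite memv0 => /eqP->.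
have leP r : P r -> (r <= \dim {:V})%N.
  by move=> /asboolP[U [<- _]]; apply/dimvS/subvf.
case: (ex_maxnP exP leP) => r /asboolP[U [dimU US]] maxr.
exists U => v; split=> [Sv|]; last exact: US.
have /maxr : P (\dim (U + <[v]>)).
  apply/asboolP; exists (U + <[v]>)%VS; split=> //.
  move=> _ /memv_addP[u uU [_ /vlineP[a ->] ->]].
  by rewrite addrC; apply: SD => //; apply: US.
rewrite -dimU => leUv.
have /eqP -> : U == (U + <[v]>)%VS by rewrite eqEdim addvSl.
exact: subvP (addvSr U _) _ (memv_line v).
Qed.

(** The image of [f] is finite dimensional, so finitely many vectors of [W]
    have images spanning it; these span [W] modulo the kernel. *)
Lemma finite_codim_kernel W (V : vectType k) (f : {linear W -> V}) :
  finite_codim [set x | f x = 0].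
Proof.
have WT : submod_closed [in [set: W]] by apply/submod_closed_setE.
have [U UE] := @submod_closed_vspace V _ (@submod_closed_image _ _ f _ WT).
have /choice[e fe] (i : 'I_(\dim U)) : exists x, f x = (vbasis U)`_i.
  have /UE[x _ fx] : (vbasis U)`_i \in U.
    by apply/vbasis_mem/mem_nth; rewrite size_tuple.
  by exists x.
exists (\dim U), e => x; exists (fun i => coord (vbasis U) i (f x)).
have /coord_vbasis fxE : f x \in U by apply/UE; exists x.
rewrite /= linearB linear_sum {1}fxE -sumrB big1 // => i _.
by rewrite linearZ /= fe subrr.
Qed.

(** A spanning family modulo [U] with the fewest members is independent modulo
    [U]: a nontrivial relation would allow one member to be dropped. *)
Lemma finite_codim_basis W (U : set W) :
    submod_closed [in U] -> finite_codim U ->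
  exists (m : nat) (e : 'I_m -> W),
    (forall x, exists c : 'I_m -> k, U (x - \sum_i c i *: e i)) /\
    (forall c : 'I_m -> k, U (\sum_i c i *: e i) -> forall i, c i = 0).
Proof.
move=> /submod_closed_setE[U0 UD] Ufin.
pose P m := `[< exists e : 'I_m -> W,
  forall x, exists c : 'I_m -> k, U (x - \sum_i c i *: e i) >].
have exP : exists m, P m by have [m eP] := Ufin; exists m; apply/asboolP.
case: (ex_minnP exP) => m /asboolP[e spane] minm.
exists m, e; split=> // c Uc j.
apply/eqP/negPn/negP => cj0.
have /minm : P m.-1.
  apply/asboolP; exists (fun i => e (lift j i)) => x.
  have [d Ud] := spane x.
  (* Subtracting a multiple of the relation c cancels the coordinate j. *)
  pose b i := d i - d j / c j * c i.
  exists (fun i => b (lift j i)).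
  have -> : \sum_(i < m.-1) b (lift j i) *: e (lift j i) = \sum_i b i *: e i.
    by rewrite [RHS](bigD1_ord j) //= {2}/b divfK // subrr scale0r add0r.
  suff -> : x - \sum_i b i *: e i =
            d j / c j *: (\sum_i c i *: e i) + (x - \sum_i d i *: e i).
    exact: UD.
  rewrite addrCA; congr (_ + _); rewrite scaler_sumr -sumrB -sumrN.
  by apply: eq_bigr => i _; rewrite scalerA -scalerBl -scaleNr opprB.
by rewrite leqNgt ltn_predL (leq_ltn_trans _ (ltn_ord j)).
Qed.

(** The coordinates on a basis modulo [U] are well defined, hence linear. *)
Lemma finite_codim_is_kernel W (U : set W) :
    submod_closed [in U] -> finite_codim U ->
  exists (m : nat) (f : {linear W -> 'rV[k]_m}), U = [set x | f x = 0].
Proof.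
move=> Usub /(finite_codim_basis Usub)[m [e [/choice[c Uc] freee]]].
have /submod_closed_setE[U0 UD] := Usub.
have cE x b : U (x - \sum_i b i *: e i) -> c x = b.
  move=> Ub; apply/funext => i; apply/eqP; rewrite -subr_eq0; apply/eqP.
  apply: (freee (fun i => c x i - b i)).
  have -> : \sum_i (c x i - b i) *: e i =
            (x - \sum_i b i *: e i) - (x - \sum_i c x i *: e i).
    rewrite opprB addrC addrA subrK -sumrB.
    by apply: eq_bigr => j _; rewrite scalerBl.
  exact: submod_closedB_set.
pose f x : 'rV[k]_m := \row_i c x i.
have f_linear : linear f.
  move=> a x y; apply/rowP => i; rewrite !mxE.
  rewrite (cE _ (fun i => a * c x i + c y i)) //.
  have -> : a *: x + y - \sum_j (a * c x j + c y j) *: e j =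
            a *: (x - \sum_j c x j *: e j) + (y - \sum_j c y j *: e j).
    rewrite scalerBr addrACA -opprD scaler_sumr -big_split; congr (_ - _).
    by apply: eq_bigr => j _; rewrite scalerDl scalerA.
  exact: UD.
pose fL : {linear W -> 'rV[k]_m} :=
  HB.pack f (GRing.isLinear.Build k W 'rV[k]_m *:%R f f_linear).
exists m, fL; apply/predeqP => x /=; split=> [Ux | fx0].
  apply/rowP => i; rewrite !mxE (cE _ (fun=> 0)) //.
  by rewrite big1 ?subr0 // => j _; rewrite scale0r.
suff cx0 i : c x i = 0.
  by have := Uc x; rewrite big1 ?subr0 // => i _; rewrite cx0 scale0r.
by move/rowP/(_ i): fx0; rewrite !mxE.
Qed.

Lemma finite_codimI W (U V : set W) :
    submod_closed [in U] -> submod_closed [in V] ->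
  finite_codim U -> finite_codim V -> finite_codim (U `&` V).
Proof.
move=> Usub Vsub /(finite_codim_is_kernel Usub)[p [f ->]].
move=> /(finite_codim_is_kernel Vsub)[q [g ->]].
pose E : vectType k := ('rV[k]_p * 'rV[k]_q)%type.
pose h x : E := (f x, g x).
have h_linear : linear h by move=> a x y; rewrite /h !linearP.
pose hL : {linear W -> E} :=
  HB.pack h (GRing.isLinear.Build k W E *:%R h h_linear).
rewrite (_ : _ `&` _ = [set x | hL x = 0]); first exact: finite_codim_kernel.
by apply/predeqP => x /=; split=> [[fx gx]|[]]; rewrite /h ?fx ?gx.
Qed.

Lemma finite_codim_power W n (I : set W) :
    submod_closed [in I] -> finite_codim I ->
  finite_codim [set a : {ffun 'I_n -> W} | forall i, I (a i)].
Proof.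
move=> Isub /(finite_codim_is_kernel Isub)[p [f ->]].
pose h (a : {ffun 'I_n -> W}) : 'M[k]_(n, p) := \matrix_(i, j) f (a i) 0 j.
have h_linear : linear h.
  by move=> b x y; apply/matrixP => i j; rewrite !mxE !ffunE linearP !mxE.
pose hL : {linear {ffun 'I_n -> W} -> 'M[k]_(n, p)} := HB.pack h
  (GRing.isLinear.Build k {ffun 'I_n -> W} 'M[k]_(n, p) *:%R h h_linear).
rewrite (_ : [set a | _] = [set x | hL x = 0]).
  exact: finite_codim_kernel.
apply/predeqP => x /=; split=> [fx|hx i].
  by apply/matrixP => i j; rewrite !mxE fx mxE.
by apply/rowP => j; move/matrixP/(_ i j): hx; rewrite !mxE.
Qed.

End FiniteCodimension.

(** * The codimension of a subset *)

Section PointCodimension.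
Variable k : fieldType.

Lemma zariski_closed_origin m : @zariski_closed k m [set fun=> 0].
Proof.
exists [set p | exists i, p = mpoly.mpolyX k (mpoly.mnm1 i)].
apply/predeqP => x /=; split=> [-> _ [i ->]|x0]; first by rewrite mpoly.mevalXU.
apply/funext => i; rewrite -(mpoly.mevalXU x i).
by apply: x0; exists i.
Qed.

Lemma has_dim_origin m : @has_dim k m [set fun=> 0] 0.
Proof.
split.
  exists (fun=> [set fun=> 0]); split=> // i _; split=> //; split.
  - exact: zariski_closed_origin.
  - by exists (fun=> 0).
  - by move=> Z1 Z2 _ _ sZ; have [Z10|Z20] := sZ _ erefl;
      [left|right] => _ ->.
case=> Z [irrZ ltZ]; have [[_ [x Z0x] _] sZ0] := irrZ 0%N isT.
have [_ sZ1] := irrZ 1%N isT.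
have [_] := ltZ 0%N isT; apply=> y /sZ1 ->.
by rewrite -(sZ0 x Z0x).
Qed.

Lemma codim_fin (W : lmodType k) (X : set W) :
  codim X <> None <-> exists c, contains_algebraic X c.
Proof. by rewrite /codim; case: pselect. Qed.

(** The span of a basis modulo [U] is a complement of [U], and its origin is a
    closed set of dimension zero. *)
Lemma contains_algebraic_subspace (W : lmodType k) (U X : set W) :
    submod_closed [in U] -> finite_codim U -> U `<=` X ->
  exists c, contains_algebraic X c.
Proof.
move=> Usub Ufin UX; have /submod_closed_setE[U0 UD] := Usub.
have [m [e [spane freee]]] := finite_codim_basis Usub Ufin.
pose comb (c : 'I_m -> k) := \sum_i c i *: e i.
have comb0 : comb (fun=> 0) = 0.
  by rewrite /comb big1 // => i _; rewrite scale0r.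
exists m, U, (comb @` setT), [set 0]; split.
- split=> //.
  + apply/submod_closed_setE; split; first by exists (fun=> 0).
    move=> a _ _ [b _ <-] [c _ <-]; exists (fun i => a * b i + c i) => //.
    rewrite /comb scaler_sumr -big_split; apply: eq_bigr => i _ /=.
    by rewrite scalerDl scalerA.
  + apply/predeqP => x /=; split=> [[Ux [c _ cx]]|->].
      rewrite -cx /comb big1 // => i _; rewrite (freee c) ?scale0r //.
      by rewrite -/(comb c) cx.
    by split=> //; exists (fun=> 0).
  + move=> x; have [c Uc] := spane x.
    by exists (x - comb c), (comb c); split=> //; rewrite subrK.
- exists m, e, [set fun=> 0], 0%N; split.
  + by split=> // c c0; apply: freee; rewrite c0.
  + exact: zariski_closed_origin.
  + apply/predeqP => x /=; split=> [->|[_ -> <-]]; last exact: comb0.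
    by exists (fun=> 0).
  + exact: has_dim_origin.
  + by rewrite addn0.
- by move=> v _ /UX Xv ->; rewrite addr0.
Qed.

(** A set that has a dimension has a point, so a subset of finite codimension
    contains a whole coset of the subspace [V1] of its decomposition. *)
Lemma contains_algebraic_coset (W : lmodType k) (X : set W) c :
    contains_algebraic X c ->
  exists U b, [/\ submod_closed [in U], finite_codim U
                & forall v, U v -> X (b + v)].
Proof.
case=> V1 [V2 [X2 [[V1sub _ _ V12] [m [e [Y [d]]]]]]].
case=> -[V2E _] _ X2E [[Z [irrZ _]] _] _ VX.
have [[_ [y Zy] _] /(_ _ Zy) Yy] := irrZ 0%N isT.
exists V1, (\sum_i y i *: e i); split=> // [|v Vv]; last first.
  by rewrite addrC; apply: VX => //; rewrite X2E; exists y.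
exists m, e => w; have [v1 [v2 [V1v]]] := V12 w.
rewrite V2E => -[a _ <-] ->; exists a; by rewrite addrK.
Qed.

End PointCodimension.

(** * Polynomial curves in a vector space *)

Section PolynomialCurves.
Variables (k : fieldType) (A : lmodType k).
Implicit Types f g : k -> A.

(** Giving the closure properties as constructors, instead of a list of
    coefficients, makes products of curves an induction rather than a
    computation with convolutions. *)
Inductive polynomial_curve : (k -> A) -> Prop :=
  | curve_const c : polynomial_curve (fun=> c)
  | curve_add f g : polynomial_curve f -> polynomial_curve g ->
      polynomial_curve (fun t => f t + g t)
  | curve_shift f : polynomial_curve f -> polynomial_curve (fun t => t *: f t).

Lemma polynomial_curve_scale c f :
  polynomial_curve f -> polynomial_curve (fun t => c *: f t).
Proof.
elim=> [x|g h _ cg _ ch|g _ cg]; first exact: curve_const.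
  by under eq_fun do rewrite scalerDr; apply: curve_add.
by under eq_fun do rewrite scalerA mulrC -scalerA; apply: curve_shift.
Qed.

Lemma polynomial_curve_sum m (f : 'I_m -> k -> A) :
    (forall i, polynomial_curve (f i)) ->
  polynomial_curve (fun t => \sum_i f i t).
Proof.
elim: m f => [|m IHm] f cf.
  by under eq_fun do rewrite big_ord0; apply: curve_const.
under eq_fun do rewrite big_ord_recl.
exact: curve_add (cf _) (IHm _ _).
Qed.

Lemma polynomial_curve_mul (mul : {bilinear A -> A -> A}) f g :
    polynomial_curve f -> polynomial_curve g ->
  polynomial_curve (fun t => mul (f t) (g t)).
Proof.
move=> + cg; elim=> [c|f1 f2 _ c1 _ c2|f1 _ c1].
- elim: cg => [x|g1 g2 _ c1 _ c2|g1 _ c1]; first exact: curve_const.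
    by under eq_fun do rewrite linearDr; apply: curve_add.
  by under eq_fun do rewrite linearZr; apply: curve_shift.
- by under eq_fun do rewrite linearDl; apply: curve_add.
- by under eq_fun do rewrite linearZl_LR; apply: curve_shift.
Qed.

(** Leaving the number of terms free above a bound makes expansions of
    different degrees directly addable. *)
Lemma polynomial_curve_coef f : polynomial_curve f ->
  exists (N0 : nat) (c : nat -> A),
    forall N t, (N0 <= N)%N -> f t = \sum_(j < N) t ^+ j *: c j.
Proof.
elim=> [x|g h _ [M [a ga]] _ [N [b hb]]|g _ [N [a ga]]].
- exists 1%N, (fun j => if j == 0%N then x else 0) => -[//|N] t _.
  rewrite big_ord_recl /= scale1r big1 ?addr0 // => i _.
  by rewrite scaler0.
- exists (maxn M N), (fun j => a j + b j) => K t.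
  rewrite geq_max => /andP[MK NK].
  rewrite (ga K) // (hb K) // -big_split; apply: eq_bigr => i _ /=.
  by rewrite scalerDr.
- exists N.+1, (fun j => if j is i.+1 then a i else 0) => -[//|K] t NK.
  rewrite big_ord_recl scaler0 add0r (ga K) // scaler_sumr.
  by apply: eq_bigr => i _; rewrite scalerA -exprS.
Qed.

(** The invertible Vandermonde matrix of the points expresses each coefficient
    as a linear combination of the values. *)
Lemma polynomial_coef_eq0 N (c : nat -> A) (a : 'I_N -> k) : injective a ->
    (forall i, \sum_(j < N) a i ^+ j *: c j = 0) ->
  forall j : 'I_N, c j = 0.
Proof.
move=> inja ca0 j; pose V := Vandermonde N (\row_i a i).
have Vunit : V \in unitmx.
  rewrite unitmxE unitfE det_Vandermonde; apply/prodf_neq0 => i _.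
  apply/prodf_neq0 => l il; rewrite !mxE subr_eq0.
  by apply: contraTneq il => /inja ->; rewrite ltnn.
have : \sum_i invmx V i j *: (\sum_(l < N) a i ^+ l *: c l) = 0.
  by apply: big1 => i _; rewrite ca0 scaler0.
under eq_bigr do rewrite scaler_sumr.
rewrite exchange_big (bigD1 j) //= [X in _ + X]big1 => [|l lj].
  move=> sum0; rewrite -sum0 addr0.
  under eq_bigr do rewrite scalerA mulrC.
  rewrite -scaler_suml -[LHS]scale1r; congr (_ *: _).
  have /matrixP/(_ j j) := mulmxV Vunit; rewrite !mxE eqxx mulr1n => <-.
  by apply: eq_bigr => i _; rewrite !mxE.
under eq_bigr do rewrite scalerA mulrC.
rewrite -scaler_suml (_ : \sum_i _ = 0) ?scale0r //.
have /matrixP/(_ l j) := mulmxV Vunit; rewrite !mxE (negPf lj) mulr0n.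
apply: etrans.
by apply: eq_bigr => i _; rewrite !mxE.
Qed.

End PolynomialCurves.

Lemma distinct_nonzero_scalars (k : closedFieldType) N :
  exists a : 'I_N -> k, injective a /\ forall i, a i != 0.
Proof.
have [s us ss] : exists2 s : seq k, uniq (0 :: s) & size s = N.
  elim: N => [|N [s us <-]]; first by exists [::].
  have /closed_nonrootP[x] : \prod_(y <- 0 :: s) ('X - y%:P) != 0 :> {poly k}.
    by apply/monic_neq0/monic_prod_XsubC.
  rewrite root_prod_XsubC inE negb_or => /andP[x0 xs]; exists (x :: s) => //.
  by move: us => /= /andP[s0 ->]; rewrite inE negb_or eq_sym x0 s0 xs.
move: us => /= /andP[s0 us]; exists (fun i => s`_i); split=> [i j /eqP|i].
  by rewrite nth_uniq ?ss // => /eqP/val_inj.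
by apply: contraNneq s0 => <-; rewrite mem_nth ?ss.
Qed.

Lemma polynomial_curve_eq0 (k : closedFieldType) (A : lmodType k) (f : k -> A) :
  polynomial_curve f -> (forall t, t != 0 -> f t = 0) -> f 0 = 0.
Proof.
move=> /polynomial_curve_coef[N [c fc]] f0.
have [a [inja an0]] := distinct_nonzero_scalars k N.
rewrite (fc N) // big1 // => j _.
rewrite (polynomial_coef_eq0 (c := c) inja) ?scaler0 // => i.
by rewrite -fc // f0.
Qed.

(** * Evaluation of nonassociative polynomials *)

Section HomogeneousEvaluation.
Variables (k : fieldType) (C : alg_category) (A : lmodType k).
Variables (mul : {bilinear A -> A -> A}) (n : nat).
Hypothesis mulC : in_category C mul.
Implicit Types (Q : free_alg C k n) (a b w : {ffun 'I_n -> A}).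
Local Notation ev := (@fa_eval C k n A mul).

Lemma fa_eval_sum a m (c : 'I_m -> k) (R : 'I_m -> free_alg C k n) :
  ev (\sum_i c i *: R i) a = \sum_i c i *: ev (R i) a.
Proof.
have [_ evP _] := fa_eval_morphism a mulC.
have ev0 : ev 0 a = 0.
  by have := evP (-1) 0 0; rewrite !scaleN1r oppr0 addNr addr0.
elim: m c R => [|m IHm] c R; first by rewrite !big_ord0.
by rewrite !big_ord_recl evP IHm.
Qed.

Lemma fa_eval_mon_scale u t a :
  ev (fa_mon C k u) (t *: a) = t ^+ mon_degree u *: ev (fa_mon C k u) a.
Proof.
have [evXt _ evMt] := fa_eval_morphism (t *: a) mulC.
have [evX _ evM] := fa_eval_morphism a mulC.
elim: u => [i|u IHu v IHv] /=; first by rewrite evXt evX ffunE.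
by rewrite evMt evM IHu IHv linearZl_LR linearZr /= scalerA exprD.
Qed.

Lemma fa_eval_mon_curve u w b :
  polynomial_curve (fun t => ev (fa_mon C k u) (w + t *: b)).
Proof.
elim: u => [i|u IHu v IHv] /=.
  under eq_fun => t.
    have [-> _ _] := fa_eval_morphism (w + t *: b) mulC.
    by rewrite !ffunE; over.
  by apply: curve_add; [|apply: curve_shift]; apply: curve_const.
under eq_fun => t.
  by have [_ _ ->] := fa_eval_morphism (w + t *: b) mulC; over.
exact: polynomial_curve_mul.
Qed.

Lemma homogeneous_eval Q : homogeneous Q ->
  exists d : nat, (forall t a, ev Q (t *: a) = t ^+ d *: ev Q a) /\
    (forall w b, polynomial_curve (fun t => ev Q (w + t *: b))).
Proof.
case=> d [m [c [u [ud ->]]]]; exists d; split=> [t a|w b].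
  rewrite !fa_eval_sum scaler_sumr; apply: eq_bigr => i _.
  by rewrite fa_eval_mon_scale ud !scalerA mulrC.
under eq_fun do rewrite fa_eval_sum.
apply: polynomial_curve_sum => i.
exact/polynomial_curve_scale/fa_eval_mon_curve.
Qed.

End HomogeneousEvaluation.

(** For [t] nonzero, [w + t b] is a multiple of a point of the coset [b + U],
    so [Q] vanishes there by homogeneity; polynomiality in [t] extends this to
    [t = 0]. *)
Lemma homogeneous_zero_coset (k : closedFieldType) (C : alg_category)
    (A : lmodType k) (mul : {bilinear A -> A -> A}) (n : nat)
    (Q : free_alg C k n) (U : set {ffun 'I_n -> A}) (b : {ffun 'I_n -> A}) :
    in_category C mul -> homogeneous Q -> submod_closed [in U] ->
    (forall v, U v -> fa_eval mul Q (b + v) = 0) ->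
  forall w, U w -> fa_eval mul Q w = 0.
Proof.
move=> mulC /(homogeneous_eval mulC)[d [evZ ev_curve]].
move=> /submod_closed_setE[U0 UD] Qb w Uw.
rewrite -[w]addr0 -(scale0r b).
apply: (polynomial_curve_eq0 (ev_curve w b)) => t t0.
have -> : w + t *: b = t *: (b + t^-1 *: w).
  by rewrite scalerDr scalerA divff // scale1r addrC.
by rewrite evZ Qb ?scaler0 // -[_ *: w]addr0; apply: UD.
Qed.

(** * Identities on ideals *)

Section Ideals.
Variables (k : fieldType) (A : lmodType k) (mul : {bilinear A -> A -> A}).
Implicit Types I J K : set A.

Lemma is_idealI I J :
  is_ideal mul I -> is_ideal mul J -> is_ideal mul (I `&` J).
Proof.
move=> [/submod_closed_setE[I0 ID] IM] [/submod_closed_setE[J0 JD] JM].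
split; first by apply/submod_closed_setE; split=> // a x y [? ?] [? ?];
  split; [exact: ID|exact: JD].
move=> x y [/(IM x)[? ?] /(JM x)[? ?]].
by split.
Qed.

(** The two values agree in the quotient algebra; induction on a term that
    represents [Q] avoids forming this quotient. *)
Lemma fa_eval_ideal_cong (C : alg_category) n (Q : free_alg C k n)
    (a b : {ffun 'I_n -> A}) I :
    is_ideal mul I -> (forall i, I (a i - b i)) ->
  I (fa_eval mul Q a - fa_eval mul Q b).
Proof.
move=> [Isub IM] Iab; have /submod_closed_setE[I0 ID] := Isub.
rewrite /fa_eval; elim: (repr Q) => [i||s IHs t IHt|c s IHs|s IHs t IHt] //=.
- by rewrite subrr.
- by rewrite opprD addrACA; apply: submod_closedD_set.
- by rewrite -scalerBr -[_ *: _]addr0; apply: ID.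
- (* a_s a_t - b_s b_t = a_s (a_t - b_t) + (a_s - b_s) b_t *)
  set x := term_eval mul a s; set y := term_eval mul b t.
  rewrite -[mul x _](subrK (mul x y)) -addrA -linearBr -linearBl.
  by apply: submod_closedD_set => //; [have [] := IM x _ IHt
                                      |have [] := IM y _ IHs].
Qed.

(** Such a [J] is any ideal of finite codimension for which the image of [J^n]
    modulo [U] has the least dimension: passing to a smaller ideal [J'] of
    finite codimension cannot shrink this image further. *)
Lemma ideal_power_dense n (U : set {ffun 'I_n -> A}) :
    submod_closed [in U] -> finite_codim U ->
  exists J, [/\ is_ideal mul J, finite_codim J
    & forall J' (x : {ffun 'I_n -> A}), is_ideal mul J' -> finite_codim J' ->
        J' `<=` J -> (forall i, J (x i)) ->
      exists2 y, U y & forall i, J' (x i - y i)].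
Proof.
move=> Usub /(finite_codim_is_kernel Usub)[m [f UE]].
pose power J := [set a : {ffun 'I_n -> A} | forall i, J (a i)].
have image_vspace J : is_ideal mul J ->
    exists S : {vspace 'rV[k]_m}, forall v, (f @` power J) v <-> v \in S.
  move=> [Jsub _].
  exact/submod_closed_vspace/submod_closed_image/submod_closed_power.
pose P r := `[< exists J (S : {vspace 'rV[k]_m}), [/\ is_ideal mul J,
  finite_codim J, \dim S = r & forall v, (f @` power J) v <-> v \in S] >].
have exP : exists r, P r.
  have idT : is_ideal mul setT by split=> //; apply/submod_closed_setE.
  have [S SE] := image_vspace _ idT.
  exists (\dim S); apply/asboolP; exists setT, S; split=> //.
  by exists 0%N, (fun=> 0) => x; exists (fun=> 0).
case: (ex_minnP exP) => r /asboolP[J [S [idJ finJ dimS SE]]] minr.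
exists J; split=> // J' x idJ' finJ' sJ'J Jx.
have [S' S'E] := image_vspace _ idJ'.
have S'S : (S' <= S)%VS.
  apply/subvP => v /S'E[a J'a <-]; apply/SE; exists a => // i.
  exact/sJ'J/J'a.
have /eqP eS : S' == S.
  rewrite eqEdim S'S dimS /=; apply: minr.
  by apply/asboolP; exists J', S'.
have /S'E[y J'y fy] : f x \in S' by rewrite eS; apply/SE; exists x.
exists (x - y); first by rewrite UE /= linearB fy subrr.
by move=> i; rewrite !ffunE opprB addrCA subrr addr0; apply: J'y.
Qed.

(** On the ideal [J] of the previous lemma every value of [Q] is congruent,
    modulo any ideal of finite codimension, to a value of [Q] on [U], that is
    to zero. *)
Lemma identity_on_dense_ideal (C : alg_category) n (Q : free_alg C k n)
    (U : set {ffun 'I_n -> A}) :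
    residually_finite_dim mul -> submod_closed [in U] -> finite_codim U ->
    (forall v, U v -> fa_eval mul Q v = 0) ->
  exists I, [/\ is_ideal mul I, finite_codim I & identity_on mul Q I].
Proof.
move=> resA Usub finU QU.
have [J [idJ finJ denseJ]] := ideal_power_dense Usub finU.
exists J; split=> // x Jx.
suff : [set 0] (fa_eval mul Q x) by [].
rewrite -resA => K [idK finK].
have idKJ := is_idealI idK idJ.
have finKJ : finite_codim (K `&` J).
  by apply: finite_codimI => //; [have [] := idK|have [] := idJ].
have [y Uy xy] := denseJ _ _ idKJ finKJ (@subIsetr _ _ _) Jx.
have [+ _] := fa_eval_ideal_cong Q idKJ xy.
by rewrite (QU y) // subr0.
Qed.

End Ideals.

Theorem theorem1 (k : closedFieldType) (C : alg_category)
    (A : lmodType k) (mul : {bilinear A -> A -> A}) (n : nat)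
    (Q : free_alg C k n) :
  (0 < n)%N ->
  in_category C mul ->
  residually_finite_dim mul ->
  homogeneous Q ->
  (almost_identity mul Q <->
   exists I : set A,
     [/\ is_ideal mul I, finite_codim I & identity_on mul Q I]).
Proof.
move=> _ mulC resA homQ; split.
  move=> /codim_fin[c /contains_algebraic_coset[U [b [Usub finU Qb]]]].
  apply: (identity_on_dense_ideal resA Usub finU).
  exact: homogeneous_zero_coset mulC homQ Usub Qb.
case=> I [[Isub _] finI QI]; apply/codim_fin.
apply: contains_algebraic_subspace (submod_closed_power n Isub)
  (finite_codim_power n Isub finI) _ => a Ia.
exact: QI.
Qed.
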